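(* Let $(\Gamma,G,\Lambda)$ be a splitting crystal triple in $\mathbb{R}^d$ and let $p\ge 1$ be an integer. Assume that $f:\mathbb{R}^d\to\mathbb{C}$ is compactly supported and that the translates of $f$ along $\Gamma$ are $\Gamma$-independent. If $f$ has accuracy $p$, then there exists a collection $\{v_\alpha\in\mathbb{C}: 0\le|\alpha|<p\}$ such that (i) $v_0\neq 0$; (ii) for every $0\le s<p$, $$X_{[s]}(x)=\sum_{\gamma\in\Gamma}y_{[s]}(\gamma)\,f(\gamma(x))\quad\text{for a.e. }x\in\mathbb{R}^d,$$ where $y_{[s]}(\gamma)=\sum_{t=0}^{s}\widetilde{Q}_{[s,t]}(\gamma)v_{[t]}$ and $v_{[t]}=[v_\alpha]_{|\alpha|=t}\in\mathbb{C}^{d_t}$.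
   Context: Splitting crystal triple: $\Lambda=R(\mathbb{Z}^d)$ with $R$ an invertible real $d\times d$ matrix; $G$ is a finite subgroup of the orthogonal group $\mathbf{O}(d)$ with $G\Lambda=\Lambda$; $\Gamma=\Lambda\rtimes G$ consists of the isometries $\gamma=(k,g)$, $k\in\Lambda$, $g\in G$, acting by $\gamma(x)=g(x)+k$, with product $(k,g)(k',g')=(k+gk',gg')$. Multi-index notation: $x^\alpha=x_1^{\alpha_1}\cdots x_d^{\alpha_d}$, $|\alpha|=\alpha_1+\dots+\alpha_d$; $d_s=\binom{s+d-1}{d-1}$ is the number of multi-indices of degree $s$. Define $X_{[s]}:\mathbb{R}^d\to\mathbb{R}^{d_s}$ by $X_{[s]}(x)=[x^\alpha]_{|\alpha|=s}$ (column vector). For $\gamma\in\Gamma$ and $0\le t\le s$, $\widetilde{Q}_{[s,t]}(\gamma)\in\mathbb{R}^{d_s\times d_t}$ are the matrices determined by $X_{[s]}(\gamma^{-1}(x))=\sum_{t=0}^s\widetilde{Q}_{[s,t]}(\gamma)X_{[t]}(x)$ for all $x$. Explicitly, for $\gamma=(l,g)$, $\widetilde{Q}_{[s,t]}(\gamma)=g^{-1}_{[s]}Q_{[s,t]}(l)$, where $X_{[s]}(g^{-1}x)=g^{-1}_{[s]}X_{[s]}(x)$ and $X_{[s]}(x-y)=\sum_{t=0}^sQ_{[s,t]}(y)X_{[t]}(x)$. Accuracy: $f$ has accuracy $p$ if every polynomial $q$ on $\mathbb{R}^d$ of degree $<p$ can be written as $q(x)=\sum_{\gamma\in\Gamma}b_\gamma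 f(\gamma(x))$ for a.e. $x$, with some coefficients $b_\gamma\in\mathbb{C}$ (the sum has only finitely many nonzero terms for each $x$ since $f$ is compactly supported). $\Gamma$-independence: for every family $(b_\gamma)_{\gamma\in\Gamma}$ in $\mathbb{C}$, $\sum_{\gamma\in\Gamma}b_\gamma f(\gamma(x))=0$ a.e. if and only if $b_\gamma=0$ for all $\gamma$. *)

(* Defs.v *)
From HB Require Import structures.
From mathcomp Require Import all_boot all_order all_algebra.
From mathcomp Require Import complex.
From mathcomp Require Import all_classical all_reals all_analysis.
(* The notations of multinomials clash with those of mathcomp-analysis. *)
From mathcomp Require Import -(notations) mpoly.
Set Implicit Arguments.
Unset Strict Implicit.
Unset Printing Implicit Defensive.
Import Order.TTheory GRing.Theory Num.Theory.
Import numFieldNormedType.Exports.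
Local Open Scope classical_set_scope.
Local Open Scope ring_scope.

(* (k, g) stands for the isometry x |-> g x + k. *)
Definition affisom (R : realType) (d : nat) : Type :=
  ('cV[R]_d * 'M[R]_d)%type.

Definition act (R : realType) (d : nat) (c : affisom R d) (x : 'cV[R]_d) :
  'cV[R]_d := c.2 *m x + c.1.

Definition isom_inv (R : realType) (d : nat) (c : affisom R d) :
  affisom R d := (- (invmx c.2 *m c.1), invmx c.2).

Definition is_lattice (R : realType) (d : nat) (L : set 'cV[R]_d) : Prop :=
  exists2 A : 'M[R]_d, A \in unitmx &
    L = range (fun z : 'cV[int]_d => A *m map_mx intr z).

Definition orthogonal_subgroup (R : realType) (d : nat) (G : set 'M[R]_d) :
    Prop :=
  [/\ forall g, G g -> g^T *m g = 1%:M,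
      G 1%:M,
      forall g h, G g -> G h -> G (g *m h) &
      forall g, G g -> G (invmx g)].

Definition splitting_crystal_triple (R : realType) (d : nat)
    (Gam : set (affisom R d)) (G : set 'M[R]_d) (L : set 'cV[R]_d) : Prop :=
  [/\ is_lattice L,
      orthogonal_subgroup G /\ finite_set G,
      forall g, G g -> (fun k => g *m k) @` L = L &
      Gam = [set c | L c.1 /\ G c.2]].

(* Lebesgue outer measure on R^d, by countable coverings with closed cubes
   (possibly degenerate).  Only meaningful for 0 < d. *)
Definition cube (R : realType) (d : nat) (a : 'cV[R]_d) (r : R) :
  set 'cV[R]_d := [set x | forall i, a i 0 <= x i 0 <= a i 0 + r].

Definition lebesgue_outer (R : realType) (d : nat) (A : set 'cV[R]_d) :
    \bar R :=
  ereal_inf [set (\sum_(0 <= n <oo) (r n ^+ d)%:E)%E | r in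
    [set r : nat -> R | (forall n, 0 <= r n) /\
       exists a : nat -> 'cV[R]_d, A `<=` \bigcup_n cube (a n) (r n)]].

Definition ae (R : realType) (d : nat) (P : 'cV[R]_d -> Prop) : Prop :=
  lebesgue_outer [set x | ~ P x] = 0%E.

Definition compactly_supported (R : realType) (d : nat)
    (f : 'cV[R]_d -> complex R) : Prop :=
  compact (closure [set x | f x != 0]).

(* The sums over Gam below are finitely supported sums (fsbigop), which take
   the value 0 when infinitely many terms are nonzero; this never happens for
   a compactly supported f. *)
Definition independent (R : realType) (d : nat) (Gam : set (affisom R d))
    (f : 'cV[R]_d -> complex R) : Prop :=
  forall b : affisom R d -> complex R,
    ae (fun x => \sum_(c \in Gam) b c * f (act c x) = 0) <->
    (forall c, Gam c -> b c = 0).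

(* msize q is the degree of q plus one, and 0 if q = 0. *)
Definition has_accuracy (R : realType) (d : nat) (Gam : set (affisom R d))
    (f : 'cV[R]_d -> complex R) (p : nat) : Prop :=
  forall q : mpoly d (complex R), (msize q <= p)%N ->
    exists b : affisom R d -> complex R,
      ae (fun x => meval (fun i => real_complex R (x i 0)) q =
                   \sum_(c \in Gam) b c * f (act c x)).

(* Multi-indices of degree s; bmultinom d s.+1 is the finite type of the
   multi-indices of degree < s.+1. *)
Definition midx (d s : nat) : finType :=
  {m : bmultinom d s.+1 | mdeg m == s}.

Definition dimX (d s : nat) : nat := #|midx d s|.

Definition mi (d s : nat) (i : 'I_(dimX d s)) : multinom d :=
  bmnm (val (enum_val i)).

Definition Xs (R : realType) (d s : nat) (x : 'cV[R]_d) : 'cV[R]_(dimX d s) :=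
  \col_i \prod_(k < d) x k 0 ^+ mi i k.

(* The entry (alpha, beta) is the coefficient of X^beta in
   u_1^alpha_1 ... u_d^alpha_d. *)
Definition subst_mx (R : realType) (d s t : nat) (u : 'I_d -> mpoly d R) :
    'M[R]_(dimX d s, dimX d t) :=
  \matrix_(i, j) mcoeff (mi j) (\prod_(k < d) u k ^+ mi i k).

Definition lin_mx_deg (R : realType) (d s : nat) (g : 'M[R]_d) :
    'M[R]_(dimX d s) :=
  subst_mx s s (fun k => \sum_(l < d) g k l *: mpolyX R (mnm1 l)).

Definition trans_mx (R : realType) (d s t : nat) (y : 'cV[R]_d) :
    'M[R]_(dimX d s, dimX d t) :=
  subst_mx s t (fun k => mpolyX R (mnm1 k) - mpolyC d (y k 0)).

Definition Qt (R : realType) (d s t : nat) (c : affisom R d) :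
    'M[R]_(dimX d s, dimX d t) :=
  lin_mx_deg s (invmx c.2) *m trans_mx s t c.1.

Definition mxC (R : realType) (m n : nat) (A : 'M[R]_(m, n)) :
  'M[complex R]_(m, n) := map_mx (real_complex R) A.

Definition vs (R : realType) (d : nat) (v : multinom d -> complex R)
  (t : nat) : 'cV[complex R]_(dimX d t) := \col_i v (mi i).

Definition ys (R : realType) (d : nat) (v : multinom d -> complex R)
    (s : nat) (c : affisom R d) : 'cV[complex R]_(dimX d s) :=
  \sum_(t < s.+1) mxC (Qt s t c) *m vs v t.

Section DefiningIdentities.
Variables (R : realType) (d : nat).
Implicit Types (x : 'cV[R]_d) (u : 'I_d -> mpoly d R).

Lemma mi_deg s (i : 'I_(dimX d s)) : mdeg (mi i) = s.
Proof. exact/eqP/(valP (enum_val i)). Qed.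

Lemma mi_inj s : injective (@mi d s).
Proof. by move=> i j /val_inj/val_inj/enum_val_inj. Qed.

Lemma mi_surj (m : multinom d) : exists i : 'I_(dimX d (mdeg m)), mi i = m.
Proof.
pose b : bmultinom d (mdeg m).+1 := BMultinom (ltnSn (mdeg m)).
have Pb : mdeg b == mdeg m by [].
by exists (enum_rank (Sub b Pb : midx d (mdeg m))); rewrite /mi enum_rankK SubK.
Qed.

Lemma sum_mi (V : nmodType) s t (F : multinom d -> V) : (t <= s)%N ->
  \sum_(m : bmultinom d s.+1 | mdeg m == t) F (bmnm m) =
  \sum_(i < dimX d t) F (mi i).
Proof.
move=> ts.
rewrite -(big_filter (index_enum (bmultinom d s.+1)) (fun m => mdeg m == t)).
rewrite -(big_map (@bmnm d s.+1) xpredT F) -(big_map (@mi d t) xpredT F).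
apply/perm_big/uniq_perm.
- rewrite map_inj_uniq; last exact: val_inj.
  by rewrite filter_uniq// index_enum_uniq.
- by rewrite map_inj_uniq ?index_enum_uniq//; exact: mi_inj.
move=> m; apply/mapP/mapP => [[b]|[i _ ->]].
  rewrite mem_filter => /andP[/eqP bt _ ->].
  have [i im] := mi_surj (bmnm b); rewrite -{}bt.
  by exists i; rewrite ?mem_index_enum.
have ilt : (mdeg (mi i) < s.+1)%N by rewrite mi_deg.
by exists (BMultinom ilt); rewrite // mem_filter mem_index_enum/= mi_deg eqxx.
Qed.

Lemma meval_deg (p : mpoly d R) (x : 'I_d -> R) s : (msize p <= s.+1)%N ->
  meval x p = \sum_(t < s.+1) \sum_(j < dimX d t)
    mcoeff (mi j) p * \prod_(k < d) x k ^+ mi j k.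
Proof.
move=> ps; rewrite {1}(mpolywE ps) raddf_sum/=.
pose F m := mcoeff m p * \prod_(k < d) x k ^+ fun_of_multinom m k.
pose deg (m : bmultinom d s.+1) := Ordinal (bmdeg m).
rewrite (partition_big deg xpredT)//=.
apply: eq_bigr => t _; rewrite -(@sum_mi _ s t F) -1?ltnS//.
by apply: eq_big => [m|m _]; rewrite ?mevalZ ?mevalX.
Qed.

Lemma msizeM_deg (p q : mpoly d R) m n : (msize p <= m.+1)%N ->
  (msize q <= n.+1)%N -> (msize (p * q) <= (m + n).+1)%N.
Proof.
have [->|p0] := eqVneq p 0; first by rewrite mul0r msize0.
have [->|q0] := eqVneq q 0; first by rewrite mulr0 msize0.
move=> pm qn; rewrite msizeM//.
apply: (@leq_trans (m.+1 + n.+1).-1); last by rewrite addSn addnS.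
by rewrite -!subn1; apply/leq_sub2r/leq_add.
Qed.

Lemma msize_subst u (m : multinom d) : (forall k, (msize (u k) <= 2)%N) ->
  (msize (\prod_(k < d) u k ^+ m k) <= (mdeg m).+1)%N.
Proof.
move=> u2; rewrite mdegE.
elim/big_ind2: _ => [|p i q j pi qj|k _]; [by rewrite msize1|exact: msizeM_deg|].
elim: (m k) => [|n IH]; first by rewrite expr0 msize1.
by rewrite exprS -[n.+1]add1n; exact: msizeM_deg.
Qed.

Lemma subst_mxP u s x : (forall k, (msize (u k) <= 2)%N) ->
  Xs s (\col_k meval (fun l => x l 0) (u k)) =
  \sum_(t < s.+1) subst_mx s t u *m Xs t x.
Proof.
move=> u2; apply/matrixP => i j; rewrite ord1 summxE mxE.
have := msize_subst (mi i) u2; rewrite mi_deg => us.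
transitivity (meval (fun l => x l 0) (\prod_(k < d) u k ^+ mi i k)).
  by rewrite rmorph_prod; apply: eq_bigr => k _; rewrite mxE rmorphXn.
rewrite (meval_deg _ us); apply: eq_bigr => t _.
by rewrite mxE; apply: eq_bigr => k _; rewrite !mxE.
Qed.

Lemma trans_mxP s x y :
  Xs s (x - y) = \sum_(t < s.+1) trans_mx s t y *m Xs t x.
Proof.
rewrite -subst_mxP => [|k].
  by congr Xs; apply/matrixP => k j; rewrite ord1 !mxE mevalB mevalXU mevalC.
rewrite (leq_trans (mmeasureD_le _ _ _))// mmeasureN msizeX mdeg1 mmeasureC.
by case: (_ == _).
Qed.

Lemma lin_mx_degP s (g : 'M[R]_d) x :
  Xs s (g *m x) = lin_mx_deg s g *m Xs s x.
Proof.
pose u k : mpoly d R := \sum_(l < d) g k l *: mpolyX R (mnm1 l).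
have uh k : u k \is ishomog1 1 mdeg.
  apply: rpred_sum => l _; apply/dhomogZ; rewrite dhomogX.
  by rewrite /= mdeg1.
have u2 k : (msize (u k) <= 2)%N.
  rewrite msizeE; apply/bigmax_leqP_seq => m mu _.
  by rewrite (dhomog_mf (uh k) mu).
have -> : g *m x = \col_k meval (fun l => x l 0) (u k).
  apply/matrixP => k j; rewrite ord1 !mxE raddf_sum.
  by apply: eq_bigr => l _; rewrite /= mevalZ mevalXU.
rewrite subst_mxP// big_ord_recr/= big1 ?add0r// => t _.
suff -> : subst_mx s t u = 0 by rewrite mul0mx.
apply/matrixP => i j; rewrite !mxE.
have : \prod_(k < d) u k ^+ mi i k \is ishomog1 (mdeg (mi i)) mdeg.
  rewrite mdegE.
  elim/big_ind2: _ => [|p a q b pa qb|k _].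
  - exact: dhomog1.
  - exact: dhomogM.
  - by rewrite -[X in ishomog1 X]mul1n; exact: dhomogMn.
by move/dhomog_nemf_coeff; apply; rewrite /= !mi_deg ltn_eqF.
Qed.

Lemma act_isom_inv (c : affisom R d) x :
  act (isom_inv c) x = invmx c.2 *m (x - c.1).
Proof. by rewrite /act /isom_inv mulmxBr. Qed.

(* The identity that determines the matrices Qt s t c. *)
Lemma QtP s (c : affisom R d) x :
  Xs s (act (isom_inv c) x) = \sum_(t < s.+1) Qt s t c *m Xs t x.
Proof.
rewrite act_isom_inv lin_mx_degP trans_mxP mulmx_sumr.
by apply: eq_bigr => t _; rewrite mulmxA.
Qed.

End DefiningIdentities.

(* Main.v *)
Require Import Defs.
From HB Require Import structures.
From mathcomp Require Import all_boot all_order all_algebra.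
From mathcomp Require Import complex.
From mathcomp Require Import zify.
From mathcomp Require Import all_classical all_reals all_analysis.
From mathcomp Require Import -(notations) mpoly.
Set Implicit Arguments.
Unset Strict Implicit.
Unset Printing Implicit Defensive.
Import Order.TTheory GRing.Theory Num.Theory.
Import numFieldNormedType.Exports.
Local Open Scope classical_set_scope.
Local Open Scope ring_scope.

(** Write [y_m] for a family of coefficients that expands the monomial [X^m]
    as [sum_c y_m(c) f(c x)], for each multi-index [m] of degree [< p]; accuracy
    provides one.  For [h] in [Gam] and [|m| = s], the function
    [x |-> (h^-1 x)^m] has two expansions.  Substituting [h^-1 x] in the
    expansion of [X^m] and reindexing the sum by [c |-> c h] gives the
    coefficients [c |-> y_m(c h)].  Writing [X_s(h^-1 x)] as the sum over
    [t <= s] of [Qt s t h] applied to [X_t(x)], and expanding each monomial of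
    [X_t], gives the coefficients [sum_t Qt s t h *m y_t(c)].  Independence
    identifies the two ([coeff_translate]); at [c = 1] this is
    [y_s(h) = sum_t Qt s t h *m y_t(1)], so [v_m = y_m(1)] has the required
    property.

    If [v_0] were zero, then [y_0] would vanish on [Gam], and the expansion of
    the constant polynomial would say that [1 = 0] almost everywhere.  Then the
    whole space would be null, and every family of coefficients would give an
    almost everywhere vanishing sum, against independence
    ([indep_not_ae_false]).

    Two facts support the argument.  Null sets are stable under finite unions
    and affine maps ([null_setU], [null_affine]), which allows finitely many
    expansions to be used at the same point and [x] to be replaced by
    [h^-1 x].  For each [x], only finitely many [c] in [Gam] satisfy
    [f(c x) <> 0] ([finite_active]), because [G] is finite and a bounded set
    contains finitely many lattice points; this makes the sums over [Gam]
    linear in the coefficients. *)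

(** * Entrywise bounds *)

Section Bounds.
Variable R : realType.

Lemma le_mx_norm m n (A : 'M[R]_(m, n)) i j : `|A i j| <= `|A|.
Proof.
rewrite [leRHS]mx_normrE.
exact: (@le_bigmax _ _ _ 0 (fun ij => `|A ij.1 ij.2|) (i, j)).
Qed.

Lemma mulmx_bound m n (B : 'M[R]_(m, n)) (M : R) (k : 'cV[R]_n) i : 0 <= M ->
  (forall j, `|k j 0| <= M) -> `|(B *m k) i 0| <= (\sum_i \sum_j `|B i j|) * M.
Proof.
move=> M0 kM; rewrite mxE; apply: le_trans (ler_norm_sum _ _ _) _.
apply: (@le_trans _ _ (\sum_j `|B i j| * M)).
  by apply: ler_sum => j _; rewrite normrM ler_wpM2l.
rewrite -mulr_suml ler_wpM2r// [leRHS](bigD1 i)//= lerDl sumr_ge0// => l _.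
exact: sumr_ge0.
Qed.

End Bounds.

(** * Null sets *)

Section NullSets.
Variables (R : realType) (d : nat).
Implicit Types (A B : set 'cV[R]_d) (P Q : 'cV[R]_d -> Prop).

(** The infimum that defines the outer measure is taken over sums of
    nonnegative terms, so it vanishes as soon as these sums become small. *)
Lemma null_coverP A : lebesgue_outer A = 0%E <->
  forall e : R, 0 < e -> exists r a, [/\ forall n : nat, 0 <= r n,
    A `<=` \bigcup_n cube (a n) (r n) &
    (\sum_(0 <= n <oo) (r n ^+ d)%:E <= e%:E)%E].
Proof.
split=> [A0 e e0|cov].
  have : (lebesgue_outer A < e%:E)%E by rewrite A0 lte_fin.
  move=> /ereal_inf_lt[_ [r [r0 [a Aa]] <-] re].
  by exists r, a; split=> //; exact: ltW.
apply/eqP; rewrite eq_le; apply/andP; split.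
  apply/lee_addgt0Pr => e e0; rewrite add0e.
  have [r [a [r0 Aa re]]] := cov _ e0.
  apply: le_trans re; apply: ereal_inf_lbound; exists r => //.
  by split=> //; exists a.
apply: le_ereal_inf_tmp => _ [r [r0 _] <-].
by apply: nneseries_ge0 => n _ _; rewrite lee_fin exprn_ge0.
Qed.

Lemma null_sub A B : A `<=` B -> lebesgue_outer B = 0%E ->
  lebesgue_outer A = 0%E.
Proof.
move=> AB /null_coverP B0; apply/null_coverP => e /B0[r [a [r0 Ba re]]].
by exists r, a; split=> //; exact: subset_trans Ba.
Qed.

Lemma sum_interleave (u v : nat -> R) n :
  \sum_(0 <= k < n.*2) (if odd k then v k./2 else u k./2) =
  \sum_(0 <= k < n) u k + \sum_(0 <= k < n) v k.
Proof.
elim: n => [|n IH]; first by rewrite !big_geq// addr0.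
rewrite doubleS !big_nat_recr//= IH odd_double/= uphalf_double half_double.
by rewrite -!addrA; congr (_ + _); rewrite addrCA.
Qed.

(** A covering of the union uses the two given coverings alternately, at even
    and at odd indices. *)
Lemma null_setU A B : lebesgue_outer A = 0%E -> lebesgue_outer B = 0%E ->
  lebesgue_outer (A `|` B) = 0%E.
Proof.
move=> /null_coverP A0 /null_coverP B0; apply/null_coverP => e e0.
have e20 : 0 < e / 2 by rewrite divr_gt0.
have [r [a [r0 Aa re]]] := A0 _ e20; have [s [b [s0 Bb se]]] := B0 _ e20.
pose t n := if odd n then s n./2 else r n./2.
exists t, (fun n => if odd n then b n./2 else a n./2).
have t0 n : 0 <= t n by rewrite /t; case: ifP.
split=> // [x [/Aa[n _ xn]|/Bb[n _ xn]]|].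
- by exists n.*2 => //; rewrite /t odd_double half_double.
- by exists n.*2.+1 => //; rewrite /t/= odd_double/= uphalf_double.
apply: lime_le.
  by apply: is_cvg_nneseries => n _ _; rewrite lee_fin exprn_ge0.
apply: nearW => n.
have -> : e%:E = ((e / 2)%:E + (e / 2)%:E)%E by rewrite -EFinD -splitr.
apply: (@le_trans _ _ (\sum_(0 <= k < n) (r k ^+ d)%:E +
                       \sum_(0 <= k < n) (s k ^+ d)%:E)%E); last first.
  by apply: leeD; [apply: le_trans re|apply: le_trans se];
    apply: nneseries_lim_ge => k _ _; rewrite lee_fin exprn_ge0.
rewrite !sumEFin -EFinD lee_fin -sum_interleave.
(* A partial sum of length n is at most the one of length n.*2, in which the
   two coverings separate. *)
rewrite (@big_cat_nat _ _ _ n 0 n.*2)//= -?addnn ?leq_addr//.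
have -> : \sum_(0 <= k < n) t k ^+ d = \sum_(0 <= k < n)
   (if odd k then s k./2 ^+ d else r k./2 ^+ d).
  by apply: eq_bigr => k _; rewrite /t; case: ifP.
by rewrite lerDl sumr_ge0// => k _; case: ifP => _; rewrite exprn_ge0.
Qed.

(** An affine map sends a cube of side [r] into a cube of side proportional to
    [r], and volumes of coverings are multiplied by at most a constant, which
    the smallness of a covering of a null set absorbs. *)
Lemma null_affine A (B : 'M[R]_d) (k : 'cV[R]_d) : lebesgue_outer A = 0%E ->
  lebesgue_outer ((fun x => B *m x + k) @` A) = 0%E.
Proof.
move=> /null_coverP A0; apply/null_coverP => e e0.
pose M : R := \sum_i \sum_j `|B i j|.
have M0 : 0 <= M by do 2 apply: sumr_ge0 => ? _.
pose C : R := (2 * M) ^+ d; have C0 : 0 <= C by rewrite exprn_ge0// mulr_ge0.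
have [|r [a [r0 Aa re]]] := A0 (e / (C + 1)).
  by rewrite divr_gt0// ltr_wpDl.
exists (fun n => 2 * M * r n), (fun n => B *m a n + k - const_mx (M * r n)).
split=> [n|_ [x /Aa[n _ xn] <-]|]; first by rewrite !mulr_ge0.
  exists n => // i.
  have : `|(B *m x) i 0 - (B *m a n) i 0| <= M * r n.
    have -> : (B *m x) i 0 - (B *m a n) i 0 = (B *m (x - a n)) i 0.
      by rewrite mulmxBr !mxE.
    apply: mulmx_bound => [|j]; first exact: r0.
    have -> : (x - a n) j 0 = x j 0 - a n j 0 by rewrite !mxE.
    have /andP[ax xb] := xn j.
    by rewrite ger0_norm ?subr_ge0// lerBlDl.
  have <- : (B *m x + k) i 0 - (B *m a n + k) i 0 =
            (B *m x) i 0 - (B *m a n) i 0.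
    by rewrite ![(_ + k) i 0]mxE opprD addrACA subrr addr0.
  move: ((B *m x + k) i 0) ((B *m a n + k)) => u w.
  rewrite [(w - _) i 0]mxE [(- const_mx _) i 0]mxE [const_mx _ i 0]mxE.
  rewrite ler_norml lerBrDl => /andP[-> /=].
  rewrite lerBlDl => /le_trans; apply.
  by rewrite -mulrA -addrA lerD2l mulr_natl mulr2n addKr.
under eq_eseriesr do rewrite exprMn -/C EFinM.
rewrite nneseriesZl; last by move=> n _; rewrite lee_fin exprn_ge0.
apply: (@le_trans _ _ (C%:E * (e / (C + 1))%:E)%E).
  by rewrite lee_wpmul2l.
rewrite -EFinM lee_fin mulrCA ger_pMr//.
by rewrite ler_pdivrMr ?mul1r ?lerDl// ltr_wpDl.
Qed.

Lemma ae_imp P Q : (forall x, P x -> Q x) -> ae P -> ae Q.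
Proof. by move=> PQ; apply: null_sub => x /= nQ /PQ. Qed.

Lemma ae_and P Q : ae P -> ae Q -> ae (fun x => P x /\ Q x).
Proof.
move=> aP aQ; apply: null_sub (null_setU aP aQ) => x /= /not_andP.
by case; [left|right].
Qed.

(** In dimension zero the degenerate cubes have volume [0 ^+ 0 = 1], and even
    the empty set is not null. *)
Lemma ae_all P : (0 < d)%N -> (forall x, P x) -> ae P.
Proof.
move=> d0 aP; apply/null_coverP => e e0; exists (fun=> 0), (fun=> 0).
split=> // [x /=|]; first by case.
rewrite eseries0 ?lee_fin ?ltW// => n _ _.
by rewrite expr0n eqn0Ngt d0.
Qed.

Lemma ae_forall (I : finType) (P : I -> 'cV[R]_d -> Prop) : (0 < d)%N ->
  (forall i, ae (P i)) -> ae (fun x => forall i, P i x).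
Proof.
move=> d0 aP.
suff H (s : seq I) : ae (fun x => forall i, i \in s -> P i x).
  by apply: ae_imp (H (index_enum I)) => x Px i; apply/Px/mem_index_enum.
elim: s => [|i s IH]; first exact: ae_all.
apply: ae_imp (ae_and (aP i) IH) => x [Pi Ps] j.
by rewrite inE => /orP[/eqP->|/Ps].
Qed.

Lemma isom_invK (c : affisom R d) : c.2 \in unitmx ->
  cancel (act c) (act (isom_inv c)).
Proof. by move=> cu x; rewrite act_isom_inv /act addrK mulKmx. Qed.

Lemma ae_act (c : affisom R d) P : c.2 \in unitmx -> ae P ->
  ae (fun x => P (act c x)).
Proof.
move=> cu aP.
apply: null_sub (null_affine (invmx c.2) (- (invmx c.2 *m c.1)) aP).
by move=> x nP; exists (act c x) => //; exact: (isom_invK cu).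
Qed.

End NullSets.

(** * Splitting crystal groups *)

Section Crystal.
Variables (R : realType) (d : nat).
Implicit Types (c s : affisom R d) (L : set 'cV[R]_d) (G : set 'M[R]_d).

Lemma finite_int_box (N : nat) :
  finite_set [set z : 'cV[int]_d | forall i, (`|z i 0%R| <= N)%N].
Proof.
pose h (w : 'cV['I_N.*2.+1]_d) : 'cV[int]_d := \col_i ((w i 0)%:Z - N%:Z).
apply: (@sub_finite_set _ _ (h @` setT)); last exact/finite_image/finite_finset.
move=> z /= zN; exists (\col_i inord (absz (z i 0 + N%:Z))) => //.
by apply/matrixP => i j; rewrite ord1 !mxE inordK; have := zN i; lia.
Qed.

(** The integer coordinates [invmx A *m k] of a bounded lattice point [k] are
    bounded. *)
Lemma finite_lattice_box L (M : R) : is_lattice L ->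
  finite_set (L `&` [set k | forall i, `|k i 0| <= M]).
Proof.
move=> [A Au ->].
pose K := (\sum_i \sum_j `|invmx A i j|) * `|M|.
have K0 : 0 <= K by rewrite mulr_ge0// sumr_ge0// => i _; exact: sumr_ge0.
apply: sub_finite_set (finite_image
  (fun z : 'cV[int]_d => A *m map_mx intr z) (finite_int_box (Num.bound K))).
move=> _ [[z _ <-] /= zM]; exists z => //= i.
have : `|(invmx A *m (A *m map_mx intr z)) i 0| <= K.
  by apply: mulmx_bound => // j; apply: le_trans (ler_norm _).
rewrite mulKmx// mxE -intr_norm => /le_lt_trans/(_ (archi_boundP K0)).
by rewrite -[(Num.bound K)%:R]/((Num.bound K)%:Z%:~R) ltr_int; lia.
Qed.

Variables (Gam : set (affisom R d)) (G : set 'M[R]_d) (L : set 'cV[R]_d).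
Hypothesis crystal : splitting_crystal_triple Gam G L.

(** If [g x + k] is in the support of [f], which is bounded, then [k] is in a
    bounded set that depends on [x] and [g]; each of the finitely many [g]
    leaves finitely many choices of [k]. *)
Lemma finite_active (f : 'cV[R]_d -> complex R) x : compactly_supported f ->
  finite_set (Gam `&` [set c | f (act c x) != 0]).
Proof.
have [Llat [_ Gfin] _ ->] := crystal.
move=> /compact_bounded[M [Mreal fM]].
have {}fM y i : f y != 0 -> `|y i 0| <= M + 1.
  move=> fy; apply: le_trans (le_mx_norm _ _ _) _.
  by apply: (fM (M + 1)); rewrite ?ltrDl//; exact: subset_closure.
pose box (g : 'M[R]_d) :=
  L `&` [set k | forall i, `|k i 0| <= M + 1 + `|g *m x|].
apply: (@sub_finite_set _ _ (\bigcup_(g in G) (fun k => (k, g)) @` box g)).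
  move=> [k g] [[/= Lk Gg] fkg]; exists g => //; exists k => //; split=> // i.
  have -> : k i 0 = act (k, g) x i 0 - (g *m x) i 0.
    by rewrite /act/= mxE addrAC subrr add0r.
  apply: le_trans (ler_normB _ _) _.
  by apply: lerD (fM _ _ fkg) (le_mx_norm _ _ _).
apply: bigcup_finite => // g _; apply: finite_image; exact: finite_lattice_box.
Qed.

(** The list does not depend on the summand: this turns all the sums over
    [Gam] that occur at a given [x] into sums over one finite list, where
    linearity and exchange of summations are available. *)
Lemma crystal_sum_seq (f : 'cV[R]_d -> complex R) x : compactly_supported f ->
  exists l : seq (affisom R d), forall (V : nmodType) (F : affisom R d -> V),
    (forall c, f (act c x) = 0 -> F c = 0) ->
    \sum_(c \in Gam) F c = \sum_(c <- l) F c.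
Proof.
move=> /(@finite_active _ x) fin.
pose D := Gam `&` [set c | f (act c x) != 0].
exists (finmap.enum_fset (fset_set D)) => V F F0.
rewrite -fsbig_finite//; apply/esym/fsbig_widen => [c []//|c [Gc nc]].
apply: F0; apply/eqP; apply: contrapT => /negP fc; exact: nc.
Qed.

Definition isom_mul c s : affisom R d := (c.2 *m s.1 + c.1, c.2 *m s.2).

Definition isom1 : affisom R d := (0, 1%:M).

Lemma act_mul c s x : act (isom_mul c s) x = act c (act s x).
Proof. by rewrite /act mulmxDr mulmxA addrA. Qed.

Lemma isom_1mul h : isom_mul isom1 h = h.
Proof. by case: h => k g; rewrite /isom_mul/= !mul1mx addr0. Qed.

Lemma crystal_unit c : Gam c -> c.2 \in unitmx.
Proof.
have [_ [[Gorth _ _ _] _] _ ->] := crystal => -[_ /Gorth cc].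
by have [] := mulmx1_unit cc.
Qed.

Lemma crystal1 : Gam isom1.
Proof.
have [[A _ ->] [[_ G1 _ _] _] _ ->] := crystal; split=> //.
by exists 0 => //=; rewrite map_mx0 mulmx0.
Qed.

Lemma crystal_mul c s : Gam c -> Gam s -> Gam (isom_mul c s).
Proof.
have [[A _ AL] [[_ _ GM _] _] GL ->] := crystal => -[Lc Gc] [Ls Gs].
split; last exact: GM.
have : L (c.2 *m s.1) by rewrite -(GL _ Gc); exists s.1.
move: Lc; rewrite AL /= => -[z _ <-] [w _ <-]; exists (w + z) => //=.
by rewrite map_mxD mulmxDr.
Qed.

Lemma crystal_inv c : Gam c -> Gam (isom_inv c).
Proof.
move=> Gamc; have cu := crystal_unit Gamc; move: Gamc.
have [[A _ AL] [[_ _ _ GV] _] GL ->] := crystal => -[Lc Gc].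
split; last exact: GV.
have [k + kc] : [set c.2 *m k | k in L] c.1 by rewrite GL.
rewrite /isom_inv/= -kc mulKmx// AL => -[z _ <-].
by exists (- z) => //=; rewrite map_mxN mulmxN.
Qed.

Lemma isom_mulVK s : s.2 \in unitmx ->
  cancel (isom_mul^~ s) (isom_mul^~ (isom_inv s)).
Proof.
move=> su [k g]; rewrite /isom_mul /isom_inv/= -!mulmxA !mulmxV// mulmx1.
by rewrite !mulmxN mulKVmx// addKr.
Qed.

Lemma crystal_mul_bij s : Gam s -> set_bij Gam Gam (isom_mul^~ s).
Proof.
move=> Gs; have su := crystal_unit Gs; split.
- by move=> c Gc; exact: crystal_mul.
- by move=> c c' _ _; exact: (can_inj (isom_mulVK su)).
- move=> c Gc; exists (isom_mul c (isom_inv s)).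
    exact/crystal_mul/crystal_inv.
  case: c {Gc} => k g; rewrite /isom_mul /isom_inv/=.
  by rewrite -!mulmxA mulVmx// mulmx1 mulmxN addNKr.
Qed.

End Crystal.

(** * Coefficients of the expansions of monomials *)

Section Expansions.
Variables (R : realType) (d : nat).
Variables (Gam : set (affisom R d)) (G : set 'M[R]_d) (L : set 'cV[R]_d).
Hypothesis crystal : splitting_crystal_triple Gam G L.
Variables (p : nat) (f : 'cV[R]_d -> complex R).
Hypotheses (d_gt0 : (0 < d)%N) (f_supp : compactly_supported f).
Hypotheses (f_indep : independent Gam f).

(** The entry of index [m] in [Xs (mdeg m) x]. *)
Definition mono (m : multinom d) (x : 'cV[R]_d) : R :=
  \prod_(k < d) x k 0 ^+ m k.

Definition expands (m : multinom d) (b : affisom R d -> complex R)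
    (x : 'cV[R]_d) : Prop :=
  real_complex R (mono m x) = \sum_(c \in Gam) b c * f (act c x).

Lemma accuracy_mono : has_accuracy Gam f p -> exists b, forall m,
  (mdeg m < p)%N -> ae (expands m (b m)).
Proof.
move=> acc.
have H m : exists b, (mdeg m < p)%N -> ae (expands m b).
  have [mp|_] := boolP (mdeg m < p)%N; last by exists (fun=> 0).
  have [|b] := acc (mpolyX (complex R) m); first by rewrite msizeX.
  move=> ab; exists b => _; apply: ae_imp ab => x abx.
  rewrite /expands -abx.
  by rewrite /mono mevalX rmorph_prod; apply: eq_bigr => k _; rewrite rmorphXn.
by exists (fun m => sval (cid (H m))) => m; exact: svalP (cid (H m)).
Qed.

(** Both sides, as functions of [c], are coefficients of an expansion of the
    [i]-th entry of [Xs s (act (isom_inv h) x)], so they agree by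
    independence. *)
Lemma coeff_translate (b : multinom d -> affisom R d -> complex R) (s : nat)
    (i : 'I_(dimX d s)) (h c : affisom R d) :
  (forall m, (mdeg m <= s)%N -> ae (expands m (b m))) -> Gam h -> Gam c ->
  b (mi i) (isom_mul c h) =
  \sum_(t < s.+1) \sum_(j < dimX d t)
    real_complex R (Qt s t h i j) * b (mi j) c.
Proof.
move=> ab Gh Gc; have hu := crystal_unit crystal Gh.
pose r c' := \sum_(t < s.+1) \sum_(j < dimX d t)
    real_complex R (Qt s t h i j) * b (mi j) c'.
suff /f_indep/(_ _ Gc)/eqP : ae (fun x => \sum_(c' \in Gam)
    (b (mi i) (isom_mul c' h) - r c') * f (act c' x) = 0).
  by rewrite subr_eq0 => /eqP.
(* The two expansions of the same function, at almost every point. *)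
have lower : ae (fun x => forall (t : 'I_s.+1) (j : 'I_(dimX d t)),
    expands (mi j) (b (mi j)) x).
  do 2 apply: ae_forall => // ?; apply: ab.
  by rewrite mi_deg -ltnS.
have hVu : (isom_inv h).2 \in unitmx by rewrite unitmx_inv.
have top : ae (fun x => expands (mi i) (b (mi i)) (act (isom_inv h) x)).
  by apply: ae_act => //; apply: ab; rewrite mi_deg.
apply: ae_imp (ae_and lower top) => x [xlow xtop].
have [l sumE] := crystal_sum_seq crystal x f_supp.
have sumM (a : affisom R d -> complex R) :
    \sum_(c \in Gam) a c * f (act c x) = \sum_(c <- l) a c * f (act c x).
  by apply: sumE => c' ->; rewrite mulr0.
rewrite sumM; under eq_bigr do rewrite mulrBl.
rewrite sumrB; apply/eqP; rewrite subr_eq0; apply/eqP.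
transitivity (real_complex R (Xs s (act (isom_inv h) x) i 0)).
  rewrite -sumM mxE [RHS]xtop.
  rewrite [RHS](reindex_fsbig (fun c' : affisom R d => isom_mul c' h) Gam);
    last first.
    exact: (crystal_mul_bij crystal).
  apply: eq_fsbigr => c' _; rewrite act_mul; congr (_ * f (act c' _)).
  by rewrite act_isom_inv /act mulKVmx// subrK.
rewrite QtP summxE rmorph_sum.
under [RHS]eq_bigr do rewrite mulr_suml.
rewrite exchange_big; apply: eq_bigr => t _ /=.
under [RHS]eq_bigr do rewrite mulr_suml.
rewrite exchange_big mxE rmorph_sum; apply: eq_bigr => j _ /=.
rewrite rmorphM [Xs _ _ _ _]mxE [X in _ * X](xlow t j) sumM mulr_sumr.
by apply: eq_bigr => c' _; rewrite mulrA.
Qed.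

(** The constant family [1] would give an almost everywhere vanishing sum. *)
Lemma indep_not_ae_false : ~ ae (fun _ : 'cV[R]_d => False).
Proof.
move=> aeF.
have /f_indep/(_ _ (crystal1 crystal))/eqP : ae (fun x =>
    \sum_(c \in Gam) 1 * f (act c x) = 0) by apply: ae_imp aeF.
by rewrite oner_eq0.
Qed.

End Expansions.

Theorem theorem3p1 (R : realType) (d p : nat)
    (Gam : set (affisom R d)) (G : set 'M[R]_d) (L : set 'cV[R]_d)
    (f : 'cV[R]_d -> complex R) :
  (0 < d)%N -> (0 < p)%N ->
  splitting_crystal_triple Gam G L ->
  compactly_supported f ->
  independent Gam f ->
  has_accuracy Gam f p ->
  exists v : multinom d -> complex R,
    v (@mnm0 d) != 0 /\
    forall s : nat, (s < p)%N ->
      ae (fun x => mxC (Xs s x) = \sum_(c \in Gam) f (act c x) *: ys v s c).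
Proof.
move=> d0 p0 crystal supp indep /accuracy_mono[b ab].
pose v m := b m (isom1 R d).
have bE s (i : 'I_(dimX d s)) h : (s < p)%N -> Gam h ->
    b (mi i) h = ys v s h i 0.
  move=> sp Gh; rewrite -[h in LHS]isom_1mul.
  rewrite (coeff_translate crystal d0 supp indep _ _ Gh (crystal1 crystal)).
    rewrite /ys summxE; apply: eq_bigr => t _.
    by rewrite mxE; apply: eq_bigr => j _; rewrite !mxE.
  by move=> m ms; apply/ab/leq_ltn_trans/sp.
exists v; split=> [|s sp].
  apply/eqP => v0; apply: (indep_not_ae_false crystal indep).
  apply: ae_imp (ab (@mnm0 d) _); last by rewrite mdeg0.
  move=> x; rewrite /expands /mono big1 => [|k _]; last by rewrite mnm0E expr0.
  rewrite rmorph1 fsbig1 => [/eqP|c Gc]; first by rewrite oner_eq0.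
  have mi0 (j : 'I_(dimX d 0)) : mi j = @mnm0 d.
    by apply/eqP; rewrite -mdeg_eq0 mi_deg.
  have := mi_surj (@mnm0 d); rewrite mdeg0 => -[i <-].
  rewrite bE// /ys big_ord_recl big_ord0 addr0 mxE big1 ?mul0r// => j _.
  by rewrite [vs _ _ _ _]mxE mi0 v0 mulr0.
have aX : ae (fun x => forall i : 'I_(dimX d s),
    expands Gam f (mi i) (b (mi i)) x).
  by apply: ae_forall => // i; apply: ab; rewrite mi_deg.
apply: ae_imp aX => x Xx; apply/matrixP => i j; rewrite ord1 {j}.
have [l sumE] := crystal_sum_seq crystal x supp.
rewrite sumE => [|c ->]; last by rewrite scale0r.
rewrite summxE 2!mxE [LHS]Xx.
under [RHS]eq_bigr do rewrite mxE.
rewrite -sumE => [|c ->]; last by rewrite mul0r.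
by apply: eq_fsbigr => c /set_mem Gc; rewrite bE// mulrC.
Qed.
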